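(* Let $m,n\ge 1$ be integers and let $a^{T}\in B_{\mathcal{L}(^{m}\mathbb{R}^{n})}$. The following assertions are equivalent: (i) $a^{T}\in ext\left(B_{\mathcal{L}(^{m}\mathbb{R}^{n})}\right)$, i.e. $a^T$ is an extreme point of the closed unit ball $B_{\mathcal{L}(^{m}\mathbb{R}^{n})}$; (ii) there exists a basis $\beta$ of $\mathbb{R}^{n^{m}}$ with $\beta\subseteq V_{m}^{n}$ such that $|\langle a^{T},u\rangle|=1$ for all $u\in\beta$.
   Context: $\mathbb{R}^n$ carries the sup norm and $B_{\mathbb{R}^n}$ is its closed unit ball; $[n]=\{1,\dots,n\}$; $ext(A)$ is the set of extreme points of a convex set $A$ (so $ext(B_{\mathbb{R}^n})=\{-1,1\}^n$). For $x=(x_1,\dots,x_m)$ with $x_i\in\mathbb{R}^n$ and $\mathbf{j}=(j_1,\dots,j_m)\in[n]^m$, put $x^{\mathbf{j}}=\prod_{i=1}^m x_i^{(j_i)}\in\mathbb{R}$, where $x_i^{(j)}$ is the $j$-th coordinate of $x_i$, and $\omega(x)=(x^{\mathbf{j}})_{\mathbf{j}\in[n]^m}\in\mathbb{R}^{n^m}$ (lexicographic order on $[n]^m$). Set $V_m^n=\{\omega(x): x=(x_1,\dots,x_m),\ x_i\in ext(B_{\mathbb{R}^n})\text{ for all } i\in[m]\}$. $\mathcal{L}(^m\mathbb{R}^n)$ is the space of $m$-linear forms $T:\mathbb{R}^n\times\cdots\times\mathbb{R}^n\to\mathbb{R}$ with norm $\|T\|=\sup_{\|x_1\|,\dots,\|x_m\|\le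 1}|T(x_1,\dots,x_m)|$, and $B_{\mathcal{L}(^m\mathbb{R}^n)}$ is its closed unit ball. Each $T$ is written $T(y)=\sum_{\mathbf{i}\in[n]^m}a_{\mathbf{i}}y^{\mathbf{i}}=\langle a^T,\omega(y)\rangle$ with $a^T=(a_{\mathbf{i}})_{\mathbf{i}\in[n]^m}\in\mathbb{R}^{n^m}$, and $T$ is identified with $a^T$; $\langle\cdot,\cdot\rangle$ is the standard inner product. *)

(* Defs.v *)
From HB Require Import structures.
From mathcomp Require Import all_boot all_order all_algebra.
From mathcomp Require Import all_classical all_reals all_analysis.

Set Implicit Arguments.
Unset Strict Implicit.
Unset Printing Implicit Defensive.

Import Order.TTheory GRing.Theory Num.Theory.
Import numFieldNormedType.Exports.

Local Open Scope classical_set_scope.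
Local Open Scope ring_scope.

Definition ext (R : realType) (V : lmodType R) (A : set V) : set V :=
  [set x | A x /\
    forall (y z : V) (t : R), A y -> A z -> 0 < t < 1 ->
      x = t *: y + (1 - t) *: z -> y = z].

(* The norm `|x| on row vectors is the library's max norm, i.e. the sup norm. *)
Definition unit_ball (R : realType) (n : nat) : set 'rV[R]_n :=
  [set x | `|x| <= 1].

(* The real space with coordinates indexed by [n]^m. Only the multi-index
   itself matters below, so no enumeration of [n]^m (e.g. the lexicographic one)
   is fixed. *)
Definition tensor (R : realType) (m n : nat) : vectType R :=
  {ffun {ffun 'I_m -> 'I_n} -> R^o}.

Definition omega (R : realType) (m n : nat) (x : 'I_m -> 'rV[R]_n) :
    tensor R m n :=
  [ffun j : {ffun 'I_m -> 'I_n} => \prod_(i < m) x i ord0 (j i)].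

Definition inner (R : realType) (m n : nat) (a u : tensor R m n) : R :=
  \sum_(j : {ffun 'I_m -> 'I_n}) a j * u j.

Definition Vset (R : realType) (m n : nat) : set (tensor R m n) :=
  [set omega x | x in [set x : 'I_m -> 'rV[R]_n |
                        forall i, ext (@unit_ball R n) (x i)]].

(* dfwith x i v is x with its i-th argument replaced by v. *)
Definition multilinear (R : realType) (m n : nat)
    (T : ('I_m -> 'rV[R]_n) -> R^o) : Prop :=
  forall (x : 'I_m -> 'rV[R]_n) (i : 'I_m),
    scalar (fun v : 'rV[R]_n => T (dfwith x i v)).

Definition form_norm (R : realType) (m n : nat)
    (T : ('I_m -> 'rV[R]_n) -> R^o) : R :=
  sup [set `|T x| | x in [set x : 'I_m -> 'rV[R]_n |
                           forall i, unit_ball (x i)]].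

(* The unit ball of the space of m-linear forms, as a subset of the vector space
   of all functions ('I_m -> 'rV_n) -> R with pointwise operations. *)
Definition form_ball (R : realType) (m n : nat) :
    set (('I_m -> 'rV[R]_n) -> R^o) :=
  [set T | multilinear T /\ form_norm T <= 1].

(* a^T: the coefficient of y^j in T(y) is the value of T at the tuple of
   canonical basis vectors e_(j_1), ..., e_(j_m); see multilinear_coefE. *)
Definition form_coef (R : realType) (m n : nat)
    (T : ('I_m -> 'rV[R]_n) -> R^o) : tensor R m n :=
  [ffun j : {ffun 'I_m -> 'I_n} => T (fun i => delta_mx 0 (j i))].

Lemma inner_omega_multilinear (R : realType) (m n : nat) (a : tensor R m n) :
  multilinear (fun y => inner a (omega y)).
Proof.
move=> x i c u v /=; rewrite /inner.
have E w : \sum_j a j * omega (dfwith x i w) j =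
    \sum_(j : {ffun 'I_m -> 'I_n})
      w ord0 (j i) * (a j * \prod_(k < m | k != i) x k ord0 (j k)).
  apply: eq_bigr => j _; rewrite ffunE (bigD1 i) //= dfwithin mulrCA.
  by congr (_ * (_ * _)); apply: eq_bigr => k ki; rewrite dfwithout // eq_sym.
rewrite !E -[RHS]/(c * _ + _) mulr_sumr -big_split; apply: eq_bigr => j _ /=.
by rewrite !mxE mulrDl mulrA.
Qed.

Lemma inner_omega_coef (R : realType) (m n : nat) (a : tensor R m n) :
  form_coef (fun y => inner a (omega y)) = a.
Proof.
apply/ffunP => j; rewrite ffunE /inner (bigD1 j) //= ffunE.
rewrite big1 => [|i _]; last by rewrite mxE !eqxx.
rewrite mulr1 big1 ?addr0 // => k kj; rewrite ffunE.
have [i ji] : exists i, k i != j i.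
  by apply/existsP; rewrite -negb_forall; apply: contra kj => /forallP kj;
     apply/eqP/ffunP => i; apply/eqP.
by rewrite (bigD1 i) //= mxE eqxx (negbTE ji) mul0r mulr0.
Qed.

Lemma multilinear_eq0 (R : realType) (m n : nat)
    (D : ('I_m -> 'rV[R]_n) -> R^o) : multilinear D ->
  (forall j : {ffun 'I_m -> 'I_n}, D (fun i => delta_mx 0 (j i)) = 0) ->
  forall y, D y = 0.
Proof.
move=> Dlin D0 y.
suff H k z : (forall i : 'I_m, (k <= i)%N -> exists j, z i = delta_mx 0 j) ->
    D z = 0.
  by apply: (H m) => i; rewrite leqNgt ltn_ord.
elim: k z => [|k IH] z zE.
  have {}zE i : {j | z i = delta_mx 0 j} by apply/cid/zE.
  rewrite -(D0 [ffun i => sval (zE i)]); congr D; apply/funext => i.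
  by rewrite ffunE; case: (zE i).
have [km|mk] := ltnP k m; last first.
  by apply: IH => i /(leq_trans mk); rewrite leqNgt ltn_ord.
pose i0 := Ordinal km; pose f w := D (dfwith z i0 w).
have zz : dfwith z i0 (z i0) = z.
  by apply/funext => i; case: dfwithP.
pose fL := GRing.isLinear.Build R 'rV[R]_n R^o *%R f (Dlin z i0).
pose g : {scalar 'rV[R]_n} := HB.pack f fL.
rewrite -zz -[D _]/(g (z i0)) [z i0]row_sum_delta linear_sum big1 // => j _.
rewrite linearZ; suff -> : g (delta_mx 0 j) = 0 by exact: mulr0.
apply: IH => i; case: dfwithP => [_|i' ii' ki']; first by exists j.
by apply: zE; rewrite ltn_neqAle ki' andbT -(inj_eq val_inj) in ii' *.
Qed.

Lemma multilinear_coefE (R : realType) (m n : nat)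
    (T : ('I_m -> 'rV[R]_n) -> R^o) : multilinear T ->
  forall y, T y = inner (form_coef T) (omega y).
Proof.
move=> Tlin y; apply/eqP; rewrite -subr_eq0; apply/eqP.
pose S y := inner (form_coef T) (omega y) : R^o.
apply: (@multilinear_eq0 _ _ _ (fun y => T y - S y)) => [x i c u v|j].
  by rewrite Tlin /S inner_omega_multilinear /= mulrBr opprD addrACA.
have /ffunP/(_ j) := inner_omega_coef (form_coef T).
by rewrite !ffunE /S => ->; rewrite subrr.
Qed.

(* Main.v *)
(** For the sup norm, a multilinear form attains its norm at sign vectors, one
    variable at a time, so the unit ball is the polytope cut out by the finitely
    many inequalities |<a, u>| <= 1 with u in V. A point of a polytope is extreme
    exactly when its active constraints span the dual space: otherwise it can be
    moved both ways along a vector orthogonal to all active u. *)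

From HB Require Import structures.
Require Import Defs.
From mathcomp Require Import all_boot all_order all_algebra.
From mathcomp Require Import all_classical all_reals all_analysis.
From mathcomp Require Import ring lra.

Import Order.TTheory GRing.Theory Num.Theory.
Import numFieldNormedType.Exports.

Local Open Scope classical_set_scope.
Local Open Scope ring_scope.

(** * Spans and duality for the pairing [inner] *)

Lemma free_subseq_span {K : fieldType} {vT : vectType K} (X : seq vT) :
  exists Y : seq vT, [/\ {subset Y <= X}, free Y & <<Y>>%VS = <<X>>%VS].
Proof.
elim: X => [|v X [Y [sYX freeY YX]]]; first by exists [::]; rewrite nil_free.
have [vX|vX] := boolP (v \in <<X>>%VS).
  exists Y; split=> //; first by move=> y /sYX; rewrite inE orbC => ->.
  by rewrite span_cons YX; apply/esym/addv_idPr; rewrite -memvE.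
exists (v :: Y); split; last by rewrite !span_cons YX.
  by move=> y; rewrite !inE => /orP[->//|/sYX ->]; rewrite orbT.
by rewrite free_cons YX vX.
Qed.

Lemma inner_linear {R : realType} {m n : nat} (c : R) (a b u : tensor R m n) :
  inner (c *: a + b) u = c * inner a u + inner b u.
Proof.
rewrite /inner mulr_sumr -big_split; apply: eq_bigr => j _ /=.
by rewrite !ffunE mulrDl -mulrA.
Qed.

Lemma inner_linear_r {R : realType} {m n : nat} (a : tensor R m n) :
  scalar (inner a : tensor R m n -> R).
Proof.
move=> c u v; rewrite /inner -[RHS]/(c * _ + _) mulr_sumr -big_split.
by apply: eq_bigr => j _ /=; rewrite !ffunE mulrDr mulrCA.
Qed.

Lemma inner_span {R : realType} {m n : nat} (a : tensor R m n)
    (X : seq (tensor R m n)) :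
  (forall u, u \in X -> inner a u = 0) ->
  forall u, u \in <<X>>%VS -> inner a u = 0.
Proof.
pose aL := GRing.isLinear.Build R (tensor R m n) R *%R _ (inner_linear_r a).
pose f : {scalar tensor R m n} := HB.pack (inner a) aL.
move=> aX u uX; rewrite (@coord_span _ _ _ (in_tuple X) u uX) -[LHS]/(f _) linear_sum big1 // => i _.
by rewrite linearZ /= aX ?mulr0 // mem_nth.
Qed.

Lemma inner_eq0 {R : realType} {m n : nat} (a : tensor R m n) :
  (forall u, inner a u = 0) -> a = 0.
Proof.
move=> a0; apply/ffunP => j; rewrite [RHS]ffunE.
have := a0 [ffun k => (k == j)%:R]; rewrite /inner (bigD1 j) //= ffunE eqxx mulr1.
by rewrite big1 ?addr0 // => k /negPf kj; rewrite ffunE kj mulr0.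
Qed.

Lemma scalar_inner {R : realType} {m n : nat} (f : {scalar tensor R m n}) :
  exists b : tensor R m n, forall u, f u = inner b u.
Proof.
exists [ffun j => f [ffun k => (k == j)%:R]] => u.
have {1}-> : u = \sum_j u j *: [ffun k => (k == j)%:R : R^o].
  apply/ffunP => k; rewrite sum_ffunE (bigD1 k) //= !ffunE eqxx.
  rewrite big1 => [|j]; first by rewrite addr0 -[RHS]/(u k * 1) mulr1.
  by rewrite eq_sym => /negPf jk; rewrite !ffunE jk scaler0.
rewrite linear_sum; apply: eq_bigr => j _.
by rewrite linearZ ffunE /= mulrC.
Qed.

(** For [v] outside [U], some coordinate [j] of [v - projv U v] is nonzero. The functional taking
    [w] to that coordinate of [w - projv U w] kills [U] but not [v], and the vector representing it
    is [b]. The projection is along some complement of [U], so [v - projv U v] itself need not be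
    orthogonal to [U]. *)
Lemma exists_orthogonal {R : realType} {m n : nat} {U : {vspace tensor R m n}} :
  U != fullv ->
  exists2 b : tensor R m n, b != 0 & forall u, u \in U -> inner b u = 0.
Proof.
move=> Ufull.
have [v vU] : exists v, v \notin U.
  apply: contraNP Ufull => /forallNP vU; rewrite eqEsubv subvf /=.
  by apply/subvP => v _; apply/negPn/negP/vU.
have [j vj] : exists j, (v - projv U v) j != 0.
  apply: contraNP vU => /forallNP v0.
  suff /eqP : v - projv U v = 0 by rewrite subr_eq0 => /eqP ->; exact: memv_proj.
  by apply/ffunP => j; rewrite [RHS]ffunE; apply/eqP/negPn/negP/v0.
pose g (w : tensor R m n) : R := (w - projv U w) j.
have gL : scalar g.
  move=> c x y; rewrite /g linearP /= !ffunE.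
  by rewrite -[c *: x j]/(c * x j) -[c *: projv U x j]/(c * projv U x j); ring.
pose gB := GRing.isLinear.Build R (tensor R m n) R *%R g gL.
have [b gb] := scalar_inner (HB.pack g gB : {scalar tensor R m n}).
exists b => [|u uU].
  apply: contraNneq vj => b0; rewrite -[X in X == _]/(g v) [g v]gb b0 /inner.
  by rewrite big1 // => k _; rewrite ffunE mul0r.
by rewrite -gb /= /g projv_id // subrr ffunE.
Qed.

(** * Unit balls and sign vectors *)

Lemma unit_ballP {R : realType} {n : nat} (x : 'rV[R]_n) :
  unit_ball x <-> forall j, `|x 0 j| <= 1.
Proof.
rewrite /unit_ball /= [`|x|]mx_normrE; split=> [xle j|xle].
  by apply: le_trans xle; exact: (le_bigmax _ _ (0, j)).
by apply: bigmax_le => // -[i j] _; rewrite ord1.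
Qed.

(** The endpoints of [-1, 1] are extreme: at the value 1, the nonnegative numbers [t * (1 - a)] and
    [(1 - t) * (1 - b)] add up to 0, so both vanish; -1 is symmetric. This serves both for
    coordinates of sign vectors and for values of forms. *)
Lemma conv_norm1_eq {R : realFieldType} {t a b : R} : 0 < t < 1 ->
  `|a| <= 1 -> `|b| <= 1 -> `|t * a + (1 - t) * b| = 1 -> a = b.
Proof.
move=> /andP[t0 t1]; rewrite !ler_norml => /andP[a1 a2] /andP[b1 b2] /eqP.
rewrite eqr_norml ler01 andbT => /orP[] /eqP E.
  have a1t : 0 <= t * (1 - a) by apply: mulr_ge0; lra.
  have b1t : 0 <= (1 - t) * (1 - b) by apply: mulr_ge0; lra.
  have /eqP : t * (1 - a) = 0 by lra.
  have /eqP : (1 - t) * (1 - b) = 0 by lra.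
  by rewrite !mulf_eq0 => /orP[]/eqP ? /orP[]/eqP ?; lra.
have a1t : 0 <= t * (1 + a) by apply: mulr_ge0; lra.
have b1t : 0 <= (1 - t) * (1 + b) by apply: mulr_ge0; lra.
have /eqP : t * (1 + a) = 0 by lra.
have /eqP : (1 - t) * (1 + b) = 0 by lra.
by rewrite !mulf_eq0 => /orP[]/eqP ? /orP[]/eqP ?; lra.
Qed.

Lemma ext_unit_ball_sign {R : realType} {n : nat} (x : 'rV[R]_n) :
  (forall j, `|x 0 j| = 1) -> ext (@unit_ball R n) x.
Proof.
move=> x1; split; first by apply/unit_ballP => j; rewrite x1.
move=> y z t /unit_ballP y1 /unit_ballP z1 t01 xE; apply/rowP => j.
by apply: (conv_norm1_eq t01 (y1 j) (z1 j)); have := x1 j; rewrite xE !mxE.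
Qed.

Lemma form_norm_le1P {R : realType} {m n : nat}
    {T : ('I_m -> 'rV[R]_n) -> R^o} : multilinear T ->
  form_norm T <= 1 <->
  forall x : 'I_m -> 'rV[R]_n, (forall i, unit_ball (x i)) -> `|T x| <= 1.
Proof.
move=> Tlin; split=> [T1 x xB|T1]; last first.
  apply: ge_sup => [|_ [x xB <-]]; last exact: T1.
  (* Bounding [sup] from above requires a nonempty set; the zero tuple gives a point. *)
  exists `|T (fun=> 0)|; exists (fun=> 0) => // i.
  by apply/unit_ballP => j; rewrite mxE normr0.
apply: le_trans T1; apply: ub_le_sup; last by exists x.
(* [sup] dominates its set only when the set is bounded. On the unit balls every monomial has
   absolute value at most 1, so the sum of the absolute coefficients is a bound. *)
exists (\sum_j `|form_coef T j|) => _ [{xB}x xB <-].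
rewrite multilinear_coefE //; apply: le_trans (ler_norm_sum _ _ _) _.
apply: ler_sum => j _; rewrite normrM ler_piMr // ffunE normr_prod.
apply: prodr_ile1 => i _; rewrite normr_ge0 /=.
by have /unit_ballP := xB i; apply.
Qed.

Lemma form_norm_le1_sign {R : realType} {m n : nat}
    {T : ('I_m -> 'rV[R]_n) -> R^o} : multilinear T ->
  (forall x : 'I_m -> 'rV[R]_n, (forall i j, `|x i 0 j| = 1) -> `|T x| <= 1) -> form_norm T <= 1.
Proof.
move=> Tlin T1; apply/(form_norm_le1P Tlin) => x xB.
(* Induction on [k], where the arguments of index at least [k] are already sign vectors: [k = 0] is
   the hypothesis, [k = m] the goal. *)
suff H k z : (forall i, unit_ball (z i)) ->
    (forall i : 'I_m, (k <= i)%N -> forall j, `|z i 0 j| = 1) -> `|T z| <= 1.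
  by apply: (H m) => // i; rewrite leqNgt ltn_ord.
elim: k z => [|k IH] z zB z1; first by apply: T1 => i; exact: z1.
have [km|mk] := ltnP k m; last first.
  by apply: IH => // i /(leq_trans mk); rewrite leqNgt ltn_ord.
pose i0 := Ordinal km; pose f w := T (dfwith z i0 w).
pose fL := GRing.isLinear.Build R 'rV[R]_n R^o *%R f (Tlin z i0).
pose g : {scalar 'rV[R]_n} := HB.pack f fL.
have gE w : g w = \sum_j w 0 j * g (delta_mx 0 j).
  by rewrite {1}[w]row_sum_delta linear_sum; apply: eq_bigr => j _; rewrite linearZ.
have zz : dfwith z i0 (z i0) = z by apply/funext => i; case: dfwithP.
(* The signs of the coefficients of the partial form [g], with +1 for a zero coefficient so that [s]
   is a true sign vector. Then [g s] is the sum of the absolute coefficients, which bounds [g] on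
   the unit ball. *)
pose s : 'rV[R]_n := \row_j (-1) ^+ (g (delta_mx 0 j) < 0)%R.
have s1 j : `|s 0 j| = 1 by rewrite mxE normr_sign.
apply: (@le_trans _ _ `|g s|).
  rewrite -zz -[T _]/(g (z i0)) !gE.
  rewrite [leRHS]ger0_norm; last first.
    by apply: sumr_ge0 => j _; rewrite mxE -normrEsign.
  apply: le_trans (ler_norm_sum _ _ _) _; apply: ler_sum => j _.
  rewrite normrM mxE -normrEsign ler_piMl //.
  by have /unit_ballP := zB i0; apply.
apply: IH => i; case: dfwithP => [|i' ii'] //.
  by apply/unit_ballP => j; rewrite s1.
by move=> ki'; apply: z1; rewrite ltn_neqAle ki' andbT -(inj_eq val_inj) in ii' *.
Qed.

(** * Active constraints at an extreme form *)

Definition sign_tuple {R : realType} {m n : nat}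
    (s : {ffun 'I_m * 'I_n -> bool}) (i : 'I_m) : 'rV[R]_n :=
  \row_j (-1) ^+ s (i, j).

Lemma sign_tupleP {R : realType} {m n : nat} (x : 'I_m -> 'rV[R]_n) :
  (forall i j, `|x i 0 j| = 1) -> exists s, x = sign_tuple s.
Proof.
move=> x1; exists [ffun ij => x ij.1 0 ij.2 < 0]; apply/funext => i.
by apply/rowP => j; rewrite mxE ffunE /= [LHS]realEsign ?num_real // x1 mulr1.
Qed.

(** If the span were proper, some [b != 0] would be orthogonal to all active vectors, and the
    coefficients of [T] could move by [e *: b] in both directions without leaving the ball. *)
Lemma ext_form_ball_span {R : realType} {m n : nat}
    (T : ('I_m -> 'rV[R]_n) -> R^o) (F : seq (tensor R m n)) :
  ext (@form_ball R m n) T ->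
  (forall s, `|inner (form_coef T) (omega (sign_tuple s))| = 1 ->
     omega (sign_tuple s) \in F) ->
  <<F>>%VS = fullv.
Proof.
move=> [[Tlin /(form_norm_le1P Tlin) T1] Text] FP.
apply/eqP/negPn/negP => /exists_orthogonal[b b0 bF].
pose a := form_coef T; pose W s : tensor R m n := omega (sign_tuple s).
have W1 s : `|inner a (W s)| <= 1.
  rewrite -multilinear_coefE //; apply: T1 => i.
  by apply/unit_ballP => j; rewrite mxE normr_sign.
(* The minimum runs over the finitely many boolean codes of sign tuples; 1 is its value when no
   constraint is slack. Each ratio makes [e] times the change along [b] fit in the slack, and the
   [1 +] keeps the denominator positive. *)
pose e := \big[Num.min/1]_(s | `|inner a (W s)| != 1)
  ((1 - `|inner a (W s)|) / (1 + `|inner b (W s)|)).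
have e0 : 0 < e.
  apply: lt_bigmin => // s s1; apply: divr_gt0; last by rewrite ltr_wpDr.
  by rewrite subr_gt0 lt_neqAle s1 W1.
have moved c : `|c| = e ->
    form_ball (fun y => inner (c *: b + a) (omega y)).
  move=> ce; have lin := @inner_omega_multilinear R m n (c *: b + a).
  split=> //; apply: (form_norm_le1_sign lin) => x /sign_tupleP[s ->].
  rewrite inner_linear -/(W s).
  (* An active value is unchanged, by orthogonality; an inactive one changes by at most its
     slack. *)
  have [s1|s1] := eqVneq `|inner a (W s)| 1.
    by rewrite bF ?mulr0 ?add0r // memv_span // FP.
  apply: le_trans (ler_normD _ _) _; rewrite normrM ce -lerBrDr.
  have b1 : 0 < 1 + `|inner b (W s)| by rewrite ltr_wpDr.
  have /(ler_wpM2r (ltW b1)) : e <= (1 - `|inner a (W s)|) / (1 + `|inner b (W s)|).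
    exact: bigmin_le_cond.
  rewrite divfK ?gt_eqF //; apply: le_trans; rewrite ler_wpM2l ?ltW //.
  by rewrite ltrDr.
have eE : `|e| = e by rewrite gtr0_norm.
have half : 0 < (2^-1 : R) < 1 by lra.
(* [T] is the midpoint of the two moved forms, so extremality gives [e *: b = - e *: b], impossible
   as [e > 0] and [b != 0]. *)
have TE : T = 2^-1 *: (fun y => inner (e *: b + a) (omega y) : R^o)
    + (1 - 2^-1) *: (fun y => inner (- e *: b + a) (omega y) : R^o).
  apply/funext => y.
  rewrite multilinear_coefE // -/a -[RHS]/(2^-1 * _ + (1 - 2^-1) * _).
  by rewrite !inner_linear; lra.
have := Text _ _ _ (moved e eE) (moved (- e) (etrans (normrN e) eE)) half TE.
move=> /(congr1 (@form_coef R m n)); rewrite !inner_omega_coef => /addIr/eqP.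
rewrite scaleNr -addr_eq0 -scalerDl scaler_eq0 (negPf b0) orbF => /eqP.
by lra.
Qed.

Theorem theorem13 (R : realType) (m n : nat) (hm : (1 <= m)%N) (hn : (1 <= n)%N)
    (T : ('I_m -> 'rV[R]_n) -> R^o) (hT : form_ball T) :
  ext (@form_ball R m n) T <->
  (exists beta : seq (tensor R m n),
     [/\ basis_of fullv beta,
         [set` beta] `<=` @Vset R m n
       & forall u, u \in beta -> `|inner (form_coef T) u| = 1]).
Proof.
split=> [Text|[beta [/andP[/eqP spanb _] betaV beta1]]].
  pose W s : tensor R m n := omega (sign_tuple s).
  (* The active vectors of V span the space, so a basis can be extracted from them. *)
  pose F := [seq W s | s <- enum {ffun 'I_m * 'I_n -> bool}
                     & `|inner (form_coef T) (W s)| == 1].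
  have spanF : <<F>>%VS = fullv.
    apply: (ext_form_ball_span _ _ Text) => s s1.
    by apply/mapP; exists s; rewrite // mem_filter s1 eqxx mem_enum.
  have [beta [betaF betafree betaspan]] := free_subseq_span F.
  exists beta; split=> [|u /betaF/mapP[s _ ->]|u /betaF/mapP[s]].
  - by rewrite /basis_of betaspan spanF eqxx.
  - exists (sign_tuple s) => // i; apply: ext_unit_ball_sign => j.
    by rewrite mxE normr_sign.
  - by rewrite mem_filter => /andP[/eqP s1 _ ->].
split=> // Y Z t [Ylin /(form_norm_le1P Ylin) Y1] [Zlin /(form_norm_le1P Zlin) Z1].
move=> t01 TE.
(* A form is determined by its coefficients, and these by their pairings with the spanning list
   [beta]. *)
suff YZ : form_coef Y = form_coef Z.
  by apply/funext => y; rewrite !multilinear_coefE // YZ.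
apply/eqP; rewrite -subr_eq0; apply/eqP/inner_eq0 => u.
apply: (inner_span _ beta) => [{}u ubeta|]; last by rewrite spanb memvf.
(* At [u = omega x], the value of [T] is 1 or -1 and is a proper convex combination of [Y x] and
   [Z x], both in [-1, 1]; hence these agree. *)
have [x xext xu] := betaV _ ubeta; have xB i : unit_ball (x i) := (xext i).1.
have := beta1 _ ubeta; rewrite -xu -multilinear_coefE; last by case: hT.
rewrite TE => /(conv_norm1_eq t01 (Y1 _ xB) (Z1 _ xB)).
rewrite !multilinear_coefE // => YZ.
by rewrite addrC -scaleN1r inner_linear YZ mulN1r addNr.
Qed.
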